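(* Suppose that there exists a countable family $\mathcal C$ of subsets of $E$ such that $\mathcal E=\sigma(\mathcal C)$, and that $(E,\mathcal E,\mu)$ is a finite measure space. Then $(\widetilde{\mathcal E},d_\mu)$ is separable.
   Context: $\sigma(\mathcal C)$ is the $\sigma$-algebra on $E$ generated by $\mathcal C$. For $A\in\mathcal E$ let $[A]=\{B\in\mathcal E:\mu(A\Delta B)=0\}$, where $\Delta$ is symmetric difference, and $\widetilde{\mathcal E}=\{[A]:A\in\mathcal E\}$, with metric $d_\mu([A],[B])=\mu(A\Delta B)^{1/2}$. *)

(* Defs.v *)
From HB Require Import structures.
From mathcomp Require Import all_boot all_order all_algebra.
From mathcomp Require Import all_classical all_reals all_analysis.

Set Implicit Arguments.
Unset Strict Implicit.
Unset Printing Implicit Defensive.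

Import Order.TTheory GRing.Theory Num.Theory.
Import numFieldNormedType.Exports.

Local Open Scope classical_set_scope.
Local Open Scope ring_scope.

Definition separable (T : topologicalType) := exists2 S : set T, countable S & dense S.

Section measure_algebra.
Context {d : measure_display} {E : measurableType d} {R : realType}.
Variable mu : {finite_measure set E -> \bar R}.

(* [A]; `+` is symmetric difference *)
Definition measure_class (A : set E) : set (set E) :=
  [set B | measurable B /\ mu (A `+` B) = 0%E].

Definition measure_algebra : Type :=
  set_type [set measure_class A | A in @measurable d E].

HB.instance Definition _ := Choice.on measure_algebra.

Definition to_measure_algebra (A : set E) (mA : measurable A) :
    measure_algebra :=
  exist _ (measure_class A) (mem_set (imageP measure_class mA)).

Fact measure_algebra_reprP (X : measure_algebra) :
  exists2 A : set E, measurable A & measure_class A = val X.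
Proof. exact: set_mem (valP X). Qed.

Definition measure_algebra_repr (X : measure_algebra) : set E :=
  s2val (cid2 (measure_algebra_reprP X)).

(* independent of the chosen representatives, see [measure_distE] *)
Definition measure_dist (X Y : measure_algebra) : R :=
  Num.sqrt (fine (mu (measure_algebra_repr X `+` measure_algebra_repr Y))).

Local Notation repr := measure_algebra_repr.

Lemma measurable_repr X : measurable (repr X).
Proof. exact: s2valP (cid2 (measure_algebra_reprP X)). Qed.

Lemma measure_class_repr X : measure_class (repr X) = val X.
Proof. exact: s2valP' (cid2 (measure_algebra_reprP X)). Qed.

Lemma measurable_symdiff (A B : set E) :
  measurable A -> measurable B -> measurable (A `+` B).
Proof. by move=> mA mB; apply: measurableU; exact: measurableD. Qed.

Lemma measure_symdiff_triangle (A B C : set E) :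
  measurable A -> measurable B -> measurable C ->
  (mu (A `+` C) <= mu (A `+` B) + mu (B `+` C))%E.
Proof.
move=> mA mB mC; have mAB := measurable_symdiff mA mB.
have mBC := measurable_symdiff mB mC; have mAC := measurable_symdiff mA mC.
apply: (@le_trans _ _ (mu ((A `+` B) `|` (B `+` C)))); last exact: measureU2.
apply: le_measure; rewrite ?inE //; first exact: measurableU.
move=> x /=; have [?|?] := pselect (B x); tauto.
Qed.

Lemma measure_class_refl (A : set E) : measurable A -> measure_class A A.
Proof. by move=> mA; split=> //; rewrite setYK measure0. Qed.

Lemma eq_measure_class (A B : set E) : measurable A -> measurable B ->
  mu (A `+` B) = 0%E -> measure_class A = measure_class B.
Proof.
have sub A' B' : measurable A' -> measurable B' -> mu (A' `+` B') = 0%E ->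
    measure_class A' `<=` measure_class B'.
  move=> mA mB AB0 C [mC AC0]; split=> //; apply/eqP.
  rewrite eq_le measure_ge0 andbT.
  apply: (le_trans (measure_symdiff_triangle mB mA mC)).
  by rewrite AC0 setYC AB0 adde0.
move=> mA mB AB0; apply/seteqP; split; first exact: sub.
by apply: sub => //; rewrite setYC.
Qed.

Lemma measure_distE (A B : set E) (mA : measurable A) (mB : measurable B) :
  measure_dist (to_measure_algebra mA) (to_measure_algebra mB) =
  Num.sqrt (fine (mu (A `+` B))).
Proof.
have repr0 C (mC : measurable C) :
    mu (C `+` repr (to_measure_algebra mC)) = 0%E.
  suff [] : measure_class C (repr (to_measure_algebra mC)) by [].
  rewrite -[X in X _]/(val (to_measure_algebra mC)) -measure_class_repr.
  exact/measure_class_refl/measurable_repr.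
rewrite /measure_dist; congr (Num.sqrt (fine _)).
set A' := repr _; set B' := repr _.
have mA' : measurable A' by exact: measurable_repr.
have mB' : measurable B' by exact: measurable_repr.
have A0 : mu (A `+` A') = 0%E by exact: repr0.
have B0 : mu (B `+` B') = 0%E by exact: repr0.
apply/eqP; rewrite eq_le; apply/andP; split.
- apply: (le_trans (measure_symdiff_triangle mA' mA mB')).
  rewrite setYC A0 add0e.
  by apply: (le_trans (measure_symdiff_triangle mA mB mB')); rewrite B0 adde0.
- apply: (le_trans (measure_symdiff_triangle mA mA' mB)).
  rewrite A0 add0e; apply: (le_trans (measure_symdiff_triangle mA' mB' mB)).
  by rewrite (setYC B') B0 adde0.
Qed.

Let fin_symdiff (X Y : measure_algebra) : mu (repr X `+` repr Y) \is a fin_num.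
Proof. exact/fin_num_measure/measurable_symdiff/measurable_repr/measurable_repr. Qed.

Let measure_distxx (X : measure_algebra) : measure_dist X X = 0.
Proof. by rewrite /measure_dist setYK measure0 sqrtr0. Qed.

Let measure_dist_positivity (X Y : measure_algebra) :
  measure_dist X Y = 0 -> X = Y.
Proof.
move=> /eqP; rewrite sqrtr_eq0 => XY; apply/val_inj.
rewrite -!measure_class_repr; apply: eq_measure_class;
  [exact: measurable_repr..|].
apply/eqP; rewrite eq_le measure_ge0 andbT.
by rewrite -(fineK (fin_symdiff X Y)) lee_fin.
Qed.

Let measure_dist_sym (X Y : measure_algebra) :
  measure_dist X Y = measure_dist Y X.
Proof. by rewrite /measure_dist setYC. Qed.

Let measure_dist_triangle (Y X Z : measure_algebra) :
  measure_dist X Z <= measure_dist X Y + measure_dist Y Z.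
Proof.
rewrite /measure_dist.
have mr := measurable_repr.
have : fine (mu (repr X `+` repr Z)) <=
    fine (mu (repr X `+` repr Y)) + fine (mu (repr Y `+` repr Z)).
  rewrite -fineD ?fin_symdiff// fine_le ?fin_numD ?fin_symdiff//.
  exact: measure_symdiff_triangle.
have := fine_ge0 (measure_ge0 mu (repr X `+` repr Y)).
have := fine_ge0 (measure_ge0 mu (repr Y `+` repr Z)).
move: (fine _) (fine _) (fine _) => a b c a0 b0 cab.
rewrite -[leRHS]ger0_norm ?addr_ge0 ?sqrtr_ge0// -sqrtr_sqr.
apply: ler_wsqrtr; rewrite sqrrD !sqr_sqrtr//.
apply: (le_trans cab); rewrite addrAC lerDl.
by rewrite mulrn_wge0// mulr_ge0 ?sqrtr_ge0.
Qed.

HB.instance Definition _ := @isMetric.Build R measure_algebra measure_dist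
  measure_distxx measure_dist_positivity measure_dist_sym measure_dist_triangle.

End measure_algebra.

(* Main.v *)
Require Import Defs.
From mathcomp Require Import all_boot all_order all_algebra.
From mathcomp Require Import all_classical all_reals all_analysis.

(* The ring of sets generated by the countable family C and the whole space is
   countable, and the measurable sets that are limits in mu-measure of its
   members form a monotone class. By the monotone class theorem this class
   contains sigma(C), so the classes of the members of the ring are dense. *)

Import Order.TTheory GRing.Theory Num.Theory.

Local Open Scope classical_set_scope.
Local Open Scope ring_scope.

Section ring_terms.
Context {T : Type}.
Variable f : nat -> set T.

(* Ill-formed nodes denote the empty set. *)
Fixpoint ring_term_set (t : GenTree.tree nat) : set T :=
  match t with
  | GenTree.Leaf n => f n
  | GenTree.Node 0 [:: a; b] => ring_term_set a `|` ring_term_set b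
  | GenTree.Node 1 [:: a; b] => ring_term_set a `\` ring_term_set b
  | GenTree.Node _ _ => set0
  end.

End ring_terms.

(** Each member of the ring is the value of a finite term built by union and difference over an
    enumeration of [C], and there are countably many trees over [nat]. *)
Lemma countable_generated_setring (T : Type) (C : set (set T)) :
  countable C -> countable <<r C >>.
Proof.
move=> /pfcard_geP Ccount.
have [f Cf] : exists f : nat -> set T, C `<=` range f.
  case: Ccount => [->|[f]]; first by exists (fun=> set0).
  by exists f => A CA; apply: (@surj _ _ _ _ f).
apply: (@sub_countable _ _ _ (range (ring_term_set f))).
  apply: subset_card_le; apply: smallest_sub.
    split.
    - by exists (GenTree.Node 2 [::]).
    - by move=> _ _ [a _ <-] [b _ <-]; exists (GenTree.Node 0 [:: a; b]).
    - by move=> _ _ [a _ <-] [b _ <-]; exists (GenTree.Node 1 [:: a; b]).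
  by move=> A /Cf [n _ <-]; exists (GenTree.Leaf n).
exact: sub_countable (card_image_le _ _) (countableP _).
Qed.

(* [setT] is adjoined because a sigma-ring need not contain the whole space. *)
Lemma sub_g_sigma_algebra_setring (T : Type) (C : set (set T)) :
  <<s C >> `<=` <<sr <<r setT |` C >> >>.
Proof.
have [sr0 srD srU] := smallest_sigma_ring <<r setT |` C >>.
have gen A : (setT |` C) A -> <<sr <<r setT |` C >> >> A.
  by move=> CA; apply: sub_gen_smallest; exact: sub_gen_smallest.
apply: smallest_sub.
  (* Complements are differences from the whole space, itself a generator. *)
  by split=> // A srA; apply: srD => //; apply: gen; left.
by move=> A CA; apply: gen; right.
Qed.

Section approximation.
Context {R : realType} {d : measure_display} {E : measurableType d}.
Variable mu : {finite_measure set E -> \bar R}.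

Definition approximable (G : set (set E)) : set (set E) :=
  [set A | measurable A /\
    forall e : R, 0 < e -> exists2 B, G B & (mu (A `+` B) < e%:E)%E].

(** Continuity from above at the empty set, available because [mu] is finite. *)
Lemma nonincreasing_measure_lt (F : (set E)^nat) (e : R) : 0 < e ->
  (forall n, measurable (F n)) -> nonincreasing_seq F ->
  \bigcap_n F n = set0 -> exists n, (mu (F n) < e%:E)%E.
Proof.
move=> e0 mF niF F0.
have finF n : mu (F n) \is a fin_num by exact: fin_num_measure.
have cvgF : mu \o F @ \oo --> mu (\bigcap_n F n).
  apply: nonincreasing_cvg_mu => //; last by rewrite F0.
  by rewrite ltey_eq finF.
rewrite F0 measure0 in cvgF.
have [n _ /(_ n (leqnn n)) /= Fn] := cvgr_lt _ (fine_cvg cvgF) _ e0.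
by exists n; rewrite -(fineK (finF n)) lte_fin.
Qed.

Lemma monotone_approximable (G : set (set E)) :
  G `<=` measurable -> monotone (approximable G).
Proof.
move=> mG.
(* Both halves reduce to this: the sets [L `+` F n] decrease to [set0] when [L]
   is the union or the intersection of a monotone sequence [F]. *)
have lim (F : (set E)^nat) L : measurable L ->
    nonincreasing_seq (fun n => L `+` F n) ->
    \bigcap_n (L `+` F n) = set0 -> (forall n, approximable G (F n)) ->
    approximable G L.
  move=> mL niLF LF0 GF; split=> // e e0.
  (* One half bounds the step from [L] to some [F n], the other the step from [F n] to a member of
     [G]. *)
  have e20 : 0 < e / 2 by rewrite divr_gt0.
  have mF n : measurable (F n) by case: (GF n).
  have [n LFn] : exists n, (mu (L `+` F n) < (e / 2)%:E)%E.
    by apply: nonincreasing_measure_lt => // n; exact: measurable_symdiff.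
  have [_ /(_ _ e20) [B GB FnB]] := GF n.
  exists B => //.
  apply: le_lt_trans (measure_symdiff_triangle mu mL (mF n) (mG _ GB)) _.
  by rewrite [e]splitr EFinD; exact: lteD.
split=> F mF GF; apply: (lim F) => //.
- by apply: bigcup_measurable => n _; case: (GF n).
- move=> m n /mF /subsetPset Fmn; apply/subsetPset => x [[LFx nFx]|[Fx]].
    by left; split=> // /Fmn.
  by case; exists n.
(* As [F 0] lies in the union, [x] is in the union but in no [F n], which is absurd. *)
- rewrite -subset0 => x capx.
  have [[[n _ Fnx] _]|[F0x]] := capx 0%N I; last by case; exists 0%N.
  by have [[]|[_]] := capx n I => //; case; exists n.
- by apply: bigcap_measurable => // n _; case: (GF n).
- move=> m n /mF /subsetPset Fmn; apply/subsetPset => x [[LFx []]|[Fx nLx]].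
    exact: LFx.
  by right; split=> //; exact: Fmn.
(* Dually, [x] is outside the intersection yet in every [F n]. *)
- rewrite -subset0 => x capx.
  have [[Lx []]|[_]] := capx 0%N I; first exact: Lx.
  by case=> n _; have [[Lx []]|[]//] := capx n I; exact: Lx.
Qed.

Lemma generated_approximable (C : set (set E)) :
  @measurable d E = <<s C >> ->
  <<r setT |` C >> `<=` measurable /\
  measurable `<=` approximable <<r setT |` C >>.
Proof.
move=> mC.
have mR : <<r setT |` C >> `<=` @measurable d E.
  apply: smallest_sub.
    by split=> //; [exact: measurableU|exact: measurableD].
  by move=> A [->//|CA]; rewrite mC; exact: sub_gen_smallest.
split=> // A; rewrite {1}mC => /sub_g_sigma_algebra_setring.
apply: monotone_setring_sub_g_sigma_ring.
- exact: monotone_approximable.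
- exact: smallest_setring.
(* A member of the ring approximates itself with error 0. *)
- move=> B RB; split; first exact: mR.
  by move=> e e0; exists B => //; rewrite setYK measure0 lte_fin.
Qed.

(** Lets [measure_distE] apply to an arbitrary point, such as the centre of a ball. *)
Lemma to_measure_algebra_repr (X : measure_algebra mu) :
  to_measure_algebra mu (measurable_repr X) = X.
Proof. by apply/val_inj; exact: measure_class_repr. Qed.

End approximation.

Theorem theorem3p4 (R : realType) (d : measure_display) (E : measurableType d)
    (mu : {finite_measure set E -> \bar R}) :
  (exists2 C : set (set E), countable C & @measurable d E = <<s C >>) ->
  separable (measure_algebra mu : metricType R).
Proof.
move=> [C cC mC]; have [mR RE] := generated_approximable mu C mC.
set G := <<r setT |` C >> in mR RE.
(* A total function, so that the dense set is an image of [G]; the default class is never taken on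
   [G], whose members are measurable. *)
pose cls (A : set E) : measure_algebra mu :=
  if pselect (measurable A) is left mA then to_measure_algebra mu mA
  else to_measure_algebra mu measurable0.
exists (cls @` G).
  apply: sub_countable (card_image_le _ _) _.
  apply: countable_generated_setring; rewrite -bigcup2E.
  by apply: bigcup_countable => // -[|[|n]] _ //=; exact: countable0.
move=> O [X OX]; rewrite openE => /(_ _ OX).
rewrite /interior -nbhs_ballE => -[e /= e0 XeO].
(* The distance is the square root of the measure, hence the tolerance [e ^+ 2] for a ball of radius
   [e]. *)
have [_ /(_ (e ^+ 2)) [|B GB XB]] := RE _ (measurable_repr X).
  by rewrite exprn_gt0.
have mB := mR _ GB.
exists (to_measure_algebra mu mB); split; last first.
  exists B => //; rewrite /cls; case: pselect => // mB'.
  by congr to_measure_algebra; exact: Prop_irrelevance.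
apply: XeO; rewrite ballEmdist /= -[X in mdist X _]to_measure_algebra_repr.
rewrite /mdist /= measure_distE.
rewrite -(ltr_pXn2r (n := 2)) ?nnegrE ?sqrtr_ge0 ?(ltW e0)//.
rewrite sqr_sqrtr ?fine_ge0//.
rewrite -lte_fin fineK//.
exact/fin_num_measure/measurable_symdiff/mB/measurable_repr.
Qed.
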